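(* Let $K$ be a commutative ring and let $H$ be a Hopf algebra over $K$ that is flat as a $K$-module. Let $R$ be a right $H$-comodule algebra with structure map $\rho_R : R \to R\otimes_K H$, written $\rho_R(r) = r_{(0)}\otimes r_{(1)}$. Let $\sigma: R\to R$ be a $K$-algebra endomorphism, $\delta: R\to R$ a $K$-linear $\sigma$-derivation, and let $A = R[x;\sigma,\delta]$ be the corresponding skew polynomial ring over $R$. Suppose that $\sigma$ and $\delta$ are morphisms of right $H$-comodules. Then $A$ is also a right $H$-comodule algebra, with structure map $\rho_A : A\to A\otimes_K H$ given by $$\rho_A\left(\sum_{i=0}^n r_i x^i\right) = \sum_{i=0}^n (r_i)_{(0)}x^i\otimes (r_i)_{(1)}, \qquad r_i\in R,\ 0\le i\le n.$$ Moreover, $A^{\operatorname{co}H} = R^{\operatorname{co}H}[x;\sigma,\delta]$, where on the right-hand side $\sigma$ and $\delta$ are considered restricted to $R^{\operatorname{co}H}$.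
   Context: All rings and ring morphisms are unital; algebras are associative; tensor products are over $K$; $K$-modules are assumed non-zero. Skew polynomial rings: for a ring $R$ and a ring endomorphism $\sigma$ of $R$, a $\sigma$-derivation is an additive map $\delta:R\to R$ with $\delta(rs)=\sigma(r)\delta(s)+\delta(r)s$ for all $r,s\in R$. The skew polynomial ring $A=R[x;\sigma,\delta]$ is a ring containing $R$ as a (proper) subring with $1_R=1_A$ and with a distinguished element $x$ such that $A$ is a free left $R$-module with basis $\{1,x,x^2,\dots\}$ and $xr=\sigma(r)x+\delta(r)$ for all $r\in R$. When $R$ is a $K$-algebra and $\sigma,\delta$ are $K$-linear, $A$ is a $K$-algebra containing $R$ as a subalgebra. Comodule algebras: a right $H$-comodule is a $K$-module $N$ with a $K$-linear map $\rho:N\to N\otimes H$ such that $(\operatorname{id}_N\otimes\Delta)\rho=(\rho\otimes\operatorname{id}_H)\rho$ and $(\operatorname{id}_N\otimes\varepsilon)\rho(n)=n\otimes 1$ for all $n\in N$; Heyneman–Sweedler notation (implicit summation) $\rho(n)=n_{(0)}\otimes n_{(1)}$ is used. A $K$-linear map $g:N\to L$ of right $H$-comodules is a comodule morphism if $\rho_L(g(n))=g(n_{(0)})\otimes n_{(1)}$ for all $n\in N$. A right $H$-comodule algebra is a $K$-algebra $B$ that is a right $H$-comodule whose structure map $\rho:B\to B\otimes H$ satisfies $\rho(ab)=a_{(0)}b_{(0)}\otimes a_{(1)}b_{(1)}$ and $\rho(1_B)=1_B\otimes 1_H$. Its coinvariants are $B^{\operatorname{co}H}=\{b\in B:\rho(b)=b\otimes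 1\}$, which form a subalgebra. The notation $R^{\operatorname{co}H}[x;\sigma,\delta]$ denotes the set of all $\sum_{i=0}^n r_ix^i\in A$ with every $r_i\in R^{\operatorname{co}H}$. *)

(* Defs.v *)
From HB Require Import structures.
From mathcomp Require Import all_boot all_algebra.
From mathcomp Require Import boolp classical_sets.

Set Implicit Arguments.
Unset Strict Implicit.
Unset Printing Implicit Defensive.

Import GRing.Theory.
Local Open Scope ring_scope.
Local Open Scope quotient_scope.

Reserved Notation "M ⊗ N" (at level 40, left associativity).
Reserved Notation "x *t y" (at level 40, left associativity).

(* The tensor product of two modules over a commutative ring, as formal finite
   sums of pairs modulo the congruence generated by the bilinearity relations.
   A sequence [:: (x1, y1); ...; (xk, yk)] stands for x1 ⊗ y1 + ... + xk ⊗ yk. *)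
Section TensorDef.
Variables (K : comNzRingType) (M N : lmodType K).

Inductive tens_rel : seq (M * N) -> seq (M * N) -> Prop :=
| tens_refl s : tens_rel s s
| tens_sym s t : tens_rel s t -> tens_rel t s
| tens_trans s t u : tens_rel s t -> tens_rel t u -> tens_rel s u
| tens_cat s s' t t' :
    tens_rel s s' -> tens_rel t t' -> tens_rel (s ++ t) (s' ++ t')
| tens_comm s t : tens_rel (s ++ t) (t ++ s)
| tens_addl x x' y : tens_rel [:: (x + x', y)] [:: (x, y); (x', y)]
| tens_addr x y y' : tens_rel [:: (x, y + y')] [:: (x, y); (x, y')]
| tens_scale a x y : tens_rel [:: (a *: x, y)] [:: (x, a *: y)]
| tens_zero y : tens_rel [:: (0, y)] [::].

Definition tens_relb (s t : seq (M * N)) : bool := `[< tens_rel s t >].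

Lemma tens_relb_equiv : equiv_class_of tens_relb.
Proof.
split=> [s|s t|t s u].
- exact/asboolP/tens_refl.
- by apply/asboolP/asboolP => h; apply: tens_sym.
- by move=> /asboolP h1 /asboolP h2; apply/asboolP/tens_trans; [exact: h1|].
Qed.

Canonical tens_equiv := EquivRelPack tens_relb_equiv.

Definition tensor := {eq_quot tens_equiv}.
HB.instance Definition _ := Choice.on tensor.
HB.instance Definition _ := EqQuotient.on tensor.

Implicit Types s t : seq (M * N).

Lemma tensP s t : reflect (tens_rel s t) (\pi_tensor s == \pi_tensor t).
Proof. by rewrite piE /=; exact: asboolP. Qed.

Lemma tens_eq s t : tens_rel s t -> \pi_tensor s = \pi_tensor t.
Proof. by move=> h; apply/eqP/tensP. Qed.

Lemma tens_repr s : tens_rel (repr (\pi_tensor s)) s.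
Proof. by apply/tensP; rewrite reprK. Qed.

Definition tens0 : tensor := \pi_tensor [::].
Definition tens_plus (u v : tensor) : tensor := \pi_tensor (repr u ++ repr v).
Definition fscale (a : K) s := [seq (a *: p.1, p.2) | p <- s].
Definition tens_scaling a (u : tensor) : tensor := \pi_tensor (fscale a (repr u)).

Lemma tens_plus_pi s t : tens_plus (\pi_tensor s) (\pi_tensor t) = \pi_tensor (s ++ t).
Proof. by apply: tens_eq; apply: tens_cat; apply: tens_repr. Qed.

Lemma fscale_rel a s t : tens_rel s t -> tens_rel (fscale a s) (fscale a t).
Proof.
elim=> {s t} [s|s t _|s t u _ h1 _ h2|s s' t t' _ h1 _ h2|s t|x x' y|x y y'|b x y|y].
- exact: tens_refl.
- exact: tens_sym.
- exact: tens_trans h1 h2.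
- by rewrite /fscale !map_cat; apply: tens_cat.
- by rewrite /fscale !map_cat; apply: tens_comm.
- by rewrite /= scalerDr; apply: tens_addl.
- exact: tens_addr.
- by rewrite /= scalerA mulrC -scalerA; apply: tens_scale.
- by rewrite /= scaler0; apply: tens_zero.
Qed.

Lemma tens_scaling_pi a s : tens_scaling a (\pi_tensor s) = \pi_tensor (fscale a s).
Proof. by apply: tens_eq; apply: fscale_rel; apply: tens_repr. Qed.

Lemma tens_rel_cons p s t : tens_rel s t -> tens_rel (p :: s) (p :: t).
Proof. by move=> h; rewrite -cat1s -[p :: t]cat1s; apply: tens_cat => //; apply: tens_refl. Qed.

Lemma fscaleD a b s : tens_rel (fscale (a + b) s) (fscale a s ++ fscale b s).
Proof.
elim: s => [|[x y] s ih] /=; first exact: tens_refl.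
apply: (@tens_trans _ ([:: (a *: x, y); (b *: x, y)] ++ (fscale a s ++ fscale b s))).
  by rewrite scalerDl; apply: (@tens_cat [:: _]) => //; apply: tens_addl.
apply: tens_rel_cons; rewrite -[X in tens_rel _ X]/(fscale a s ++ ([:: (b *: x, y)] ++ fscale b s)).
rewrite -[X in tens_rel X _]/([:: (b *: x, y)] ++ (fscale a s ++ fscale b s)) !catA.
by apply: tens_cat; [apply: tens_comm|apply: tens_refl].
Qed.

Lemma fscale0 s : tens_rel (fscale 0 s) [::].
Proof.
elim: s => [|[x y] s ih] /=; first exact: tens_refl.
by rewrite scale0r; apply: (@tens_cat [:: _] [::] _ [::]) => //; apply: tens_zero.
Qed.

Lemma tens_plusA : associative tens_plus.
Proof.
move=> u v w; rewrite -[u]reprK -[v]reprK -[w]reprK.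
rewrite (tens_plus_pi (repr v)) (tens_plus_pi (repr u)) (tens_plus_pi (repr u)).
by rewrite (tens_plus_pi (_ ++ _)) catA.
Qed.

Lemma tens_plusC : commutative tens_plus.
Proof.
move=> u v; rewrite -[u]reprK -[v]reprK !tens_plus_pi.
exact/tens_eq/tens_comm.
Qed.

Lemma tens_plus0 : left_id tens0 tens_plus.
Proof. by move=> u; rewrite -[u]reprK tens_plus_pi. Qed.

Lemma fscale1 s : fscale 1 s = s.
Proof. by elim: s => [|[x y] s ih] //=; rewrite scale1r ih. Qed.

Lemma tens_plusN : left_inverse tens0 (tens_scaling (-1)) tens_plus.
Proof.
move=> u; rewrite -[u]reprK tens_scaling_pi tens_plus_pi.
apply: tens_eq; rewrite -{2}[repr u]fscale1.
apply: tens_trans (tens_sym (fscaleD _ _ _)) _; rewrite addNr; exact: fscale0.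
Qed.

HB.instance Definition _ :=
  GRing.isZmodule.Build tensor tens_plusA tens_plusC tens_plus0 tens_plusN.

Fact tens_scalingA a b u : tens_scaling a (tens_scaling b u) = tens_scaling (a * b) u.
Proof.
rewrite -[u]reprK (tens_scaling_pi b) (tens_scaling_pi a) (tens_scaling_pi (a * b)).
rewrite /fscale -map_comp; congr (\pi_tensor _).
by apply: eq_map => -[x y] /=; rewrite scalerA.
Qed.

Fact tens_scaling1 : left_id 1 tens_scaling.
Proof. by move=> u; rewrite -[u]reprK tens_scaling_pi fscale1. Qed.

Fact tens_scalingDr : right_distributive tens_scaling +%R.
Proof.
move=> a u v; rewrite -[u]reprK -[v]reprK.
by rewrite [_ + _]tens_plus_pi !tens_scaling_pi [RHS]tens_plus_pi /fscale map_cat.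
Qed.

Fact tens_scalingDl u : {morph tens_scaling^~ u : a b / a + b}.
Proof.
move=> a b; rewrite -[u]reprK !tens_scaling_pi [RHS]tens_plus_pi.
exact/tens_eq/fscaleD.
Qed.

HB.instance Definition _ := GRing.Zmodule_isLmodule.Build K tensor
  tens_scalingA tens_scaling1 tens_scalingDr tens_scalingDl.

Definition tens (x : M) (y : N) : tensor := \pi_tensor [:: (x, y)].

Fact tens_linl y : linear (tens^~ y).
Proof.
move=> a x x'; rewrite [a *: tens x y]tens_scaling_pi [RHS]tens_plus_pi.
exact/tens_eq/tens_addl.
Qed.

Fact tens_linr x : linear (tens x).
Proof.
move=> a y y'; rewrite [a *: tens x y]tens_scaling_pi [RHS]tens_plus_pi.
apply: tens_eq; apply: tens_trans (tens_addr _ _ _) _.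
rewrite -cat1s -[X in tens_rel _ X]cat1s.
apply: tens_cat; [exact/tens_sym/tens_scale|exact: tens_refl].
Qed.

HB.instance Definition _ := bilinear_isBilinear.Build K M N tensor *:%R *:%R
  tens (tens_linl, tens_linr).

Lemma tens_piE s : \pi_tensor s = \sum_(p <- s) tens p.1 p.2.
Proof.
elim: s => [|[x y] s ih]; first by rewrite big_nil.
by rewrite big_cons -ih [RHS]tens_plus_pi.
Qed.

Lemma tensE (u : tensor) : u = \sum_(p <- repr u) tens p.1 p.2.
Proof. by rewrite -tens_piE reprK. Qed.

Lemma tens_ind (P : tensor -> Prop) : P 0 ->
  (forall x y u, P u -> P (tens x y + u)) -> forall u, P u.
Proof.
move=> P0 PS u; rewrite [u]tensE; elim: (repr u) => [|[x y] s ih].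
  by rewrite big_nil.
by rewrite big_cons; apply: PS.
Qed.

(* Two linear maps out of the tensor product that agree on pure tensors are
   equal; with [tliftE] below this is the universal property. *)
Lemma tens_ext (P : lmodType K) (f g : {linear tensor -> P}) :
  (forall x y, f (tens x y) = g (tens x y)) -> f =1 g.
Proof.
move=> fg; elim/tens_ind => [|x y u ih]; first by rewrite !linear0.
by rewrite !linearD fg ih.
Qed.

End TensorDef.

Notation "M ⊗ N" := (tensor M N) : type_scope.
Notation "x *t y" := (tens x y) : ring_scope.

Section TensorLift.
Variables (K : comNzRingType) (M N P : lmodType K).
Variable f : {bilinear M -> N -> P}.

Definition tlift (u : M ⊗ N) : P := \sum_(p <- repr u) f p.1 p.2.

Lemma tlift_pi s : tlift (\pi_(M ⊗ N) s) = \sum_(p <- s) f p.1 p.2.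
Proof.
rewrite /tlift; have := tens_repr s; move: (repr _) => s0.
elim=> {s0 s} [//|s t _ -> //|s t u _ -> _ -> //|s s' t t' _ h1 _ h2|s t|x x' y|x y y'|a x y|y].
- by rewrite !big_cat /= h1 h2.
- by rewrite !big_cat /= addrC.
- by rewrite !big_cons !big_nil /= !addr0 linearDl.
- by rewrite !big_cons !big_nil /= !addr0 linearDr.
- by rewrite !big_cons !big_nil /= !addr0 linearZl_LR linearZr_LR.
- by rewrite !big_cons !big_nil /= addr0 linear0l.
Qed.

Fact tlift_linear : linear tlift.
Proof.
move=> a u v; rewrite -[u]reprK -[v]reprK.
rewrite [_ *: _]tens_scaling_pi [_ + _]tens_plus_pi !tlift_pi big_cat /=.
rewrite big_map scaler_sumr; congr (_ + _); apply: eq_bigr => p _ /=.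
by rewrite linearZl_LR.
Qed.

HB.instance Definition _ :=
  GRing.isLinear.Build K (M ⊗ N) P *:%R tlift tlift_linear.

Lemma tliftE x y : tlift (x *t y) = f x y.
Proof. by rewrite tlift_pi big_seq1. Qed.

End TensorLift.

Section TensorMap.
Variables (K : comNzRingType) (M N M' N' : lmodType K).
Variables (f : {linear M -> M'}) (g : {linear N -> N'}).

Definition tmap_fun (x : M) (y : N) : M' ⊗ N' := f x *t g y.

Fact tmap_fun_linl y : linear (tmap_fun^~ y).
Proof. by move=> a x x'; rewrite /tmap_fun linearP /= linearPl. Qed.

Fact tmap_fun_linr x : linear (tmap_fun x).
Proof. by move=> a y y'; rewrite /tmap_fun linearP /= linearPr. Qed.

HB.instance Definition _ := bilinear_isBilinear.Build K M N (M' ⊗ N') *:%R *:%R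
  tmap_fun (tmap_fun_linl, tmap_fun_linr).

Definition tmap : M ⊗ N -> M' ⊗ N' := tlift tmap_fun.
HB.instance Definition _ := GRing.Linear.on tmap.

Lemma tmapE x y : tmap (x *t y) = f x *t g y.
Proof. exact: tliftE. Qed.

End TensorMap.

Section TensorAssoc.
Variables (K : comNzRingType) (M N P : lmodType K).

Definition tensl (p : P) (y : N) : N ⊗ P := y *t p.

Fact tensl_linear p : linear (tensl p).
Proof. by move=> a y y'; rewrite /tensl linearPl. Qed.

HB.instance Definition _ p :=
  GRing.isLinear.Build K N (N ⊗ P) *:%R (tensl p) (tensl_linear p).

Definition tassoc_fun (u : M ⊗ N) (p : P) : M ⊗ (N ⊗ P) := tmap idfun (tensl p) u.

Fact tassoc_fun_linl p : linear (tassoc_fun^~ p).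
Proof. by move=> a u v; rewrite /tassoc_fun linearP. Qed.

Fact tassoc_fun_linr u : linear (tassoc_fun u).
Proof.
move=> a p q; rewrite /tassoc_fun; elim/tens_ind: u => [|x y u ih].
  by rewrite !linear0 ?scaler0 ?addr0.
rewrite !linearD /= ih !tmapE /= /tensl linearPr /= linearPr /=.
by rewrite ?scalerDr addrACA.
Qed.

HB.instance Definition _ :=
  bilinear_isBilinear.Build K (M ⊗ N) P (M ⊗ (N ⊗ P)) *:%R *:%R
    tassoc_fun (tassoc_fun_linl, tassoc_fun_linr).

Definition tassoc : (M ⊗ N) ⊗ P -> M ⊗ (N ⊗ P) := tlift tassoc_fun.
HB.instance Definition _ := GRing.Linear.on tassoc.

Lemma tassocE x y z : tassoc ((x *t y) *t z) = x *t (y *t z).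
Proof. by rewrite /tassoc tliftE /= /tassoc_fun tmapE. Qed.

End TensorAssoc.

Section TensorMul.
Variables (K : comNzRingType) (A B : algType K).

Definition tmul_fun (v : A ⊗ B) (a : A) (b : B) : A ⊗ B :=
  tmap (a \*o idfun) (b \*o idfun) v.

Fact tmul_fun_linl v b : linear ((tmul_fun v)^~ b).
Proof.
move=> c a a'; rewrite /tmul_fun; elim/tens_ind: v => [|x y v ih].
  by rewrite !linear0 ?scaler0 ?addr0.
rewrite !linearD /= ih !tmapE /= mulrDl -scalerAl linearPl /=.
by rewrite ?scalerDr addrACA.
Qed.

Fact tmul_fun_linr v a : linear (tmul_fun v a).
Proof.
move=> c b b'; rewrite /tmul_fun; elim/tens_ind: v => [|x y v ih].
  by rewrite !linear0 ?scaler0 ?addr0.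
rewrite !linearD /= ih !tmapE /= mulrDl -scalerAl linearPr /=.
by rewrite ?scalerDr addrACA.
Qed.

HB.instance Definition _ v :=
  bilinear_isBilinear.Build K A B (A ⊗ B) *:%R *:%R
    (tmul_fun v) (tmul_fun_linl v, tmul_fun_linr v).

(* The product of the algebra A ⊗ B, whose unit is 1 *t 1. It is not packaged
   as a [nzRingType] since A ⊗ B may be zero for nonzero A and B. *)
Definition tmul (u v : A ⊗ B) : A ⊗ B := tlift (tmul_fun v) u.

Lemma tmulE a b c d : tmul (a *t b) (c *t d) = (a * c) *t (b * d).
Proof. by rewrite /tmul tliftE /= /tmul_fun tmapE. Qed.

Fact tmul_linl v : linear (tmul^~ v).
Proof. by move=> a u u'; rewrite /tmul linearP. Qed.

Fact tmul_linr u : linear (tmul u).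
Proof.
move=> c v w; rewrite /tmul; elim/tens_ind: u => [|x y u ih].
  by rewrite !linear0 ?scaler0 ?addr0.
rewrite !linearD /= ih !tliftE /= /tmul_fun linearP /=.
by rewrite ?scalerDr addrACA.
Qed.

HB.instance Definition _ :=
  bilinear_isBilinear.Build K (A ⊗ B) (A ⊗ B) (A ⊗ B) *:%R *:%R
    tmul (tmul_linl, tmul_linr).

End TensorMul.

Section ConvolutionMap.
Variables (K : comNzRingType) (A : algType K) (f g : {linear A -> A}).

Definition conv_fun (a b : A) : A := f a * g b.

Fact conv_fun_linl b : linear (conv_fun^~ b).
Proof. by move=> c a a'; rewrite /conv_fun linearP mulrDl -scalerAl. Qed.

Fact conv_fun_linr a : linear (conv_fun a).
Proof. by move=> c b b'; rewrite /conv_fun linearP mulrDr -scalerAr. Qed.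

HB.instance Definition _ := bilinear_isBilinear.Build K A A A *:%R *:%R
  conv_fun (conv_fun_linl, conv_fun_linr).

(* The linear map a ⊗ b |-> f a * g b. *)
Definition tconv : A ⊗ A -> A := tlift conv_fun.
HB.instance Definition _ := GRing.Linear.on tconv.

End ConvolutionMap.

Definition flat (K : comNzRingType) (M : lmodType K) : Prop :=
  forall (N P : lmodType K) (f : {linear N -> P}),
    injective f -> injective (tmap f (idfun : {linear M -> M})).

Record hopfAlgebra (K : comNzRingType) (H : algType K) := HopfAlgebra {
  comul : {linear H -> (H ⊗ H)%type};
  counit : {lrmorphism H -> K^o};
  antipode : {linear H -> H};
  comulA : forall h,
    tmap idfun comul (comul h) = tassoc (tmap comul idfun (comul h));
  counitr : forall h, tmap idfun counit (comul h) = h *t (1 : K^o);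
  counitl : forall h, tmap counit idfun (comul h) = (1 : K^o) *t h;
  comulM : forall g h, comul (g * h) = tmul (comul g) (comul h);
  comul1 : comul 1 = 1 *t 1;
  antipodel : forall h, tconv antipode idfun (comul h) = counit h *: 1;
  antipoder : forall h, tconv idfun antipode (comul h) = counit h *: 1
}.

Section Comodules.
Variables (K : comNzRingType) (H : algType K) (hopfH : hopfAlgebra H).

Record is_comodule (N : lmodType K) (rho : {linear N -> (N ⊗ H)%type}) : Prop := {
  coactA : forall n,
    tmap idfun (comul hopfH) (rho n) = tassoc (tmap rho idfun (rho n));
  coact_counit : forall n, tmap idfun (counit hopfH) (rho n) = n *t (1 : K^o)
}.

Record is_comodule_algebra (B : algType K) (rho : {linear B -> (B ⊗ H)%type}) : Prop := {
  comodule_algebra_comodule : is_comodule rho;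
  coactM : forall a b, rho (a * b) = tmul (rho a) (rho b);
  coact1 : rho 1 = 1 *t 1
}.

Definition comodule_morphism (N L : lmodType K)
    (rhoN : {linear N -> (N ⊗ H)%type}) (rhoL : {linear L -> (L ⊗ H)%type})
    (g : {linear N -> L}) : Prop :=
  forall n, rhoL (g n) = tmap g idfun (rhoN n).

Definition coinv (B : algType K) (rho : {linear B -> (B ⊗ H)%type}) : set B :=
  [set b | rho b = b *t 1].

End Comodules.

Definition skew_derivation (R : nzRingType) (sigma delta : R -> R) : Prop :=
  forall r s, delta (r * s) = sigma r * delta s + delta r * s.

Section SkewPolynomials.
Variables (K : comNzRingType) (R A : algType K).
Variables (iota : {lrmorphism R -> A}) (x : A).

(* A = R[x; sigma, delta], where R is regarded as a subalgebra of A along iota,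
   which is injective with proper image by [skew_poly_free]. *)
Record is_skew_poly (sigma delta : R -> R) : Prop := {
  skew_poly_span : forall a : A, exists (n : nat) (r : 'I_n.+1 -> R),
    a = \sum_(i < n.+1) iota (r i) * x ^+ i;
  skew_poly_free : forall (n : nat) (r : 'I_n.+1 -> R),
    \sum_(i < n.+1) iota (r i) * x ^+ i = 0 -> forall i, r i = 0;
  skew_poly_comm : forall r, x * iota r = iota (sigma r) * x + iota (delta r)
}.

(* The set written S[x; sigma, delta] for a subset S of R. *)
Definition skew_polys (S : set R) : set A :=
  [set a | exists (n : nat) (r : 'I_n.+1 -> R),
    (forall i, S (r i)) /\ a = \sum_(i < n.+1) iota (r i) * x ^+ i].

End SkewPolynomials.

(* Main.v *)
Require Import Defs.
From HB Require Import structures.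
From mathcomp Require Import all_boot all_algebra.
From mathcomp Require Import boolp classical_sets.

Set Implicit Arguments.
Unset Strict Implicit.
Unset Printing Implicit Defensive.

Import GRing.Theory.
Local Open Scope ring_scope.

(** Freeness of [A] over [R] on the powers of [x] makes [A] a direct sum of
    copies [R x^i] of the [K]-module [R], so letting the coaction of [R] act on
    each copy defines a [K]-linear map [skew_coact] on [A]. Every claim is then
    linear and can be tested on the monomials [r x^i].

    - Comodule axioms ([skew_coact_comodule]): on [R x^i] the map is the
      transport of [rho] along [r |-> r x^i], and the axioms are natural in the
      module.
    - Multiplicativity ([skew_coact_comodule_algebra]): the elements by which
      left multiplication is compatible with the coaction are closed under
      sums and products, so it is enough to treat those of [R] and [x]. For
      [x] ([skew_coact_mulx]) the relation [x r = sigma(r) x + delta(r)] turns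
      compatibility into colinearity of [sigma] and [delta].
    - Coinvariants ([coinv_skew_coact]): the coefficient map of degree [i],
      from [A] to [R], is a comodule morphism ([skew_coact_coef]), and such
      morphisms send coinvariants to coinvariants. *)

(** * Tensor products *)

Section TensorComplements.
Variable K : comNzRingType.

Lemma tmap_comp (M N M' N' M'' N'' : lmodType K)
    (f' : {linear M' -> M''}) (g' : {linear N' -> N''})
    (f : {linear M -> M'}) (g : {linear N -> N'}) u :
  tmap f' g' (tmap f g u) = tmap (f' \o f) (g' \o g) u.
Proof.
elim/tens_ind: u => [|m n u ih]; first by rewrite !linear0.
by rewrite !linearD /= ih !tmapE.
Qed.

Lemma eq_tmapl (M N M' N' : lmodType K)
    (f f' : {linear M -> M'}) (g : {linear N -> N'}) :
  f =1 f' -> tmap f g =1 tmap f' g.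
Proof. by move=> ff'; apply: tens_ext => m n /=; rewrite !tmapE ff'. Qed.

Lemma tmap_id (M N : lmodType K) (u : M ⊗ N) : tmap idfun idfun u = u.
Proof.
elim/tens_ind: u => [|m n u ih]; first by rewrite !linear0.
by rewrite !linearD /= ih !tmapE.
Qed.

Lemma tmap0l (M N M' N' : lmodType K) (g : {linear N -> N'}) (u : M ⊗ N) :
  tmap (\0 : {linear M -> M'}) g u = 0.
Proof.
elim/tens_ind: u => [|m n u ih]; first by rewrite !linear0.
by rewrite linearD /= ih tmapE linear0l addr0.
Qed.

Lemma tassoc_natural_l (M M' N P : lmodType K) (f : {linear M -> M'})
    (u : (M ⊗ N) ⊗ P) :
  tassoc (tmap (tmap f idfun) idfun u) = tmap f idfun (tassoc u).
Proof.
elim/tens_ind: u => [|v p u ih]; first by rewrite !linear0.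
rewrite !linearD /= ih tmapE; congr (_ + _).
elim/tens_ind: v => [|m n v ihv]; first by rewrite !(linear0, linear0l).
rewrite linearD /= !linearDl /= linearD /= [tassoc (_ + _)]linearD linearD /= ihv.
by rewrite tmapE !tassocE tmapE.
Qed.

Lemma tmulA (A B : algType K) : associative (@tmul K A B).
Proof.
move=> u v w; elim/tens_ind: u => [|a b u ihu].
  by rewrite !linear0l.
rewrite !linearDl /= ihu; congr (_ + _).
elim/tens_ind: v {ihu} => [|c d v ihv]; first by rewrite !(linear0l, linear0r).
rewrite !(linearDl, linearDr) /= ihv; congr (_ + _).
elim/tens_ind: w {ihv} => [|e f w ihw]; first by rewrite !linear0r.
by rewrite !linearDr /= ihw !tmulE !mulrA.
Qed.

End TensorComplements.

(** * Coefficients in a skew polynomial ring *)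

Section SkewCoordinates.
Variables (K : comNzRingType) (R A : algType K).
Variables (iota : {lrmorphism R -> A}) (x : A).
Variables (sigma delta : {linear R -> R}).
Variable skewA : is_skew_poly iota x sigma delta.

(** Ordinary polynomials serve here only as finitely supported sequences of
    coefficients: [skew_eval] is a bijection onto [A], additive and [K]-linear,
    but not multiplicative in general. *)
Definition skew_eval (p : {poly R}) : A := (map_poly iota p).[x].

Lemma skew_eval_wide n (p : {poly R}) : (size p <= n)%N ->
  skew_eval p = \sum_(i < n) iota p`_i * x ^+ i.
Proof.
move=> le_pn; rewrite /skew_eval (@horner_coef_wide _ n); last first.
  by apply: leq_trans le_pn; apply: size_poly.
by apply: eq_bigr => i _; rewrite coef_map.
Qed.

(** [{poly R}] is a module over [R], and [K] acts on it through the central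
    scalars [k%:A]. *)
Lemma skew_evalP k (p q : {poly R}) :
  skew_eval (k%:A *: p + q) = k *: skew_eval p + skew_eval q.
Proof.
have iota_alg : iota k%:A = k%:A by rewrite linearZ /= rmorph1.
by rewrite /skew_eval raddfD /= map_polyZ hornerD hornerZ /= iota_alg mulr_algl.
Qed.

Lemma skew_eval_poly n (r : 'I_n -> R) :
  skew_eval (\poly_(i < n) oapp r 0 (insub i)) = \sum_(i < n) iota (r i) * x ^+ i.
Proof.
rewrite (skew_eval_wide (size_poly _ _)); apply: eq_bigr => i _.
by rewrite coef_poly ltn_ord valK.
Qed.

Lemma skew_eval_surj a : exists p, skew_eval p = a.
Proof.
have [n [r ->]] := skew_poly_span skewA a.
by eexists; apply: skew_eval_poly.
Qed.

Lemma skew_eval_inj : injective skew_eval.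
Proof.
move=> p q eq_pq; apply/eqP; rewrite -subr_eq0; apply/eqP; set d := p - q.
have : skew_eval d = 0.
  by rewrite /d addrC -scaleN1r -[-1 : R]scaleN1r skew_evalP eq_pq scaleN1r addNr.
rewrite (skew_eval_wide (leqnSn _)) => /(skew_poly_free skewA) d0.
apply/polyP=> i; rewrite coef0; have [lt_i|] := ltnP i (size d).+1.
  exact: d0 (Ordinal lt_i).
by move=> /ltnW; apply: nth_default.
Qed.

Definition skew_coords (a : A) : {poly R} := projT1 (cid (skew_eval_surj a)).

Lemma skew_coordsK : cancel skew_coords skew_eval.
Proof. by move=> a; rewrite /skew_coords; case: cid. Qed.

Lemma skew_evalK : cancel skew_eval skew_coords.
Proof. by move=> p; apply: skew_eval_inj; rewrite skew_coordsK. Qed.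

Definition skew_coef i (a : A) : R := (skew_coords a)`_i.

Fact skew_coef_linear i : linear (skew_coef i).
Proof.
move=> k a b; rewrite /skew_coef -{1}[a]skew_coordsK -{1}[b]skew_coordsK.
by rewrite -skew_evalP skew_evalK coefD coefZ mulr_algl.
Qed.

HB.instance Definition _ i :=
  GRing.isLinear.Build K A R *:%R (skew_coef i) (skew_coef_linear i).

Lemma skew_coef_sum n (r : 'I_n -> R) i :
  skew_coef i (\sum_(j < n) iota (r j) * x ^+ j) = oapp r 0 (insub i).
Proof.
rewrite -skew_eval_poly /skew_coef skew_evalK coef_poly.
by case: insubP => [j lt_i _|/negbTE ->] //; rewrite lt_i.
Qed.

Lemma skew_coef_monom i j r :
  skew_coef i (iota r * x ^+ j) = if i == j then r else 0.
Proof.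
(* A monomial is a full sum whose only nonzero coefficient is the last one. *)
pose s (k : 'I_j.+1) := if k == ord_max then r else 0.
have -> : iota r * x ^+ j = \sum_(k < j.+1) iota (s k) * x ^+ k.
  rewrite (bigD1 ord_max) //= {1}/s eqxx big1 ?addr0 // => k /negbTE neq_k.
  by rewrite /s neq_k raddf0 mul0r.
rewrite skew_coef_sum; case: insubP => [k _ /= <-|]; first by rewrite /s -val_eqE.
by rewrite -leqNgt; case: eqP => // -> ; rewrite ltnn.
Qed.

Lemma skew_expand a :
  a = \sum_(i < size (skew_coords a)) iota (skew_coef i a) * x ^+ i.
Proof. by rewrite -[LHS]skew_coordsK -(skew_eval_wide (leqnn _)). Qed.

Lemma skew_ind (P : A -> Prop) : P 0 -> (forall a b, P a -> P b -> P (a + b)) ->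
  (forall r i, P (iota r * x ^+ i)) -> forall a, P a.
Proof. by move=> P0 PD Pm a; rewrite [a]skew_expand; apply: big_ind. Qed.

(** * The extended coaction *)

Section Extension.
Variables (H : algType K) (rho : {linear R -> (R ⊗ H)%type}).

Definition coact_monom i (r : R) : (A ⊗ H)%type :=
  tmap (x ^+ i \o* iota) idfun (rho r).
HB.instance Definition _ i := GRing.Linear.copy (coact_monom i)
  (tmap (x ^+ i \o* iota) idfun \o rho).

Definition skew_coact (a : A) : (A ⊗ H)%type :=
  \sum_(i < size (skew_coords a)) coact_monom i (skew_coef i a).

(** Allowing any bound above the number of coefficients is what makes linearity
    provable: several elements can share one index range. *)
Lemma skew_coact_wide n a : (size (skew_coords a) <= n)%N ->
  skew_coact a = \sum_(i < n) coact_monom i (skew_coef i a).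
Proof.
move=> le_n; rewrite /skew_coact.
rewrite (big_ord_widen _ (fun i => coact_monom i (skew_coef i a)) le_n).
rewrite big_mkcond; apply: eq_bigr => i _; case: ltnP => // le_i.
by rewrite /skew_coef nth_default // linear0.
Qed.

Fact skew_coact_linear : linear skew_coact.
Proof.
move=> k a b.
pose n := maxn (size (skew_coords (k *: a + b)))
               (maxn (size (skew_coords a)) (size (skew_coords b))).
rewrite !(@skew_coact_wide n) ?leq_max ?leqnn ?orbT //.
rewrite scaler_sumr -big_split; apply: eq_bigr => i _.
by rewrite !linearP.
Qed.

HB.instance Definition _ :=
  GRing.isLinear.Build K A (A ⊗ H)%type *:%R skew_coact skew_coact_linear.

Lemma skew_coact_monom i r : skew_coact (iota r * x ^+ i) = coact_monom i r.
Proof.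
pose n := maxn i.+1 (size (skew_coords (iota r * x ^+ i))).
have lt_i : (i < n)%N by rewrite leq_max leqnn.
rewrite (@skew_coact_wide n) ?leq_max ?leqnn ?orbT //.
rewrite (bigD1 (Ordinal lt_i)) //= skew_coef_monom eqxx big1 ?addr0 // => j.
rewrite -val_eqE /= skew_coef_monom => /negbTE ->; exact: linear0.
Qed.

(** The coefficient maps are comodule morphisms: on [R x^j] the [i]-th one is
    the identity of [R] or zero. *)
Lemma skew_coact_coef i a :
  tmap (skew_coef i) idfun (skew_coact a) = rho (skew_coef i a).
Proof.
elim/skew_ind: a => [|a b iha ihb|r j]; first by rewrite !linear0.
  by rewrite !linearD /= iha ihb.
rewrite skew_coact_monom skew_coef_monom /coact_monom tmap_comp /=.
case: eqP => [->|/eqP/negbTE neq_ij].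
  rewrite -[RHS]tmap_id; apply: eq_tmapl => s /=.
  by rewrite skew_coef_monom eqxx.
rewrite linear0 -[RHS](@tmap0l K R H R H idfun (rho r)); apply: eq_tmapl => s /=.
by rewrite skew_coef_monom neq_ij.
Qed.

(** If [a] is coinvariant, applying the [i]-th coefficient map to both sides of
    [skew_coact a = a *t 1] shows that its [i]-th coefficient is too. *)
Lemma coinv_skew_coact : coinv skew_coact = skew_polys iota x (coinv rho).
Proof.
apply/seteqP; split=> a /=; last first.
  move=> [n [r [co_r ->]]]; rewrite /coinv /= linear_sum /= linear_sumlz.
  apply: eq_bigr => i _; rewrite skew_coact_monom /coact_monom.
  by rewrite (co_r i) tmapE.
move=> co_a; have [n [r def_a]] := skew_poly_span skewA a.
exists n, r; split=> // i.
have <- : skew_coef i a = r i by rewrite def_a skew_coef_sum valK.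
by rewrite /coinv /= -skew_coact_coef co_a tmapE.
Qed.

Variable hopfH : hopfAlgebra H.

(** On [R x^i] both axioms are the images of those of [rho] under
    [tmap (x ^+ i \o* iota) idfun]; for coassociativity this uses that the
    associator is natural. *)
Lemma skew_coact_comodule : is_comodule hopfH rho -> is_comodule hopfH skew_coact.
Proof.
move=> [rhoA rho1]; split=> a.
  elim/skew_ind: a => [|a b iha ihb|r i]; first by rewrite !linear0.
    by rewrite !linearD /= iha ihb.
  rewrite /= skew_coact_monom /coact_monom !tmap_comp.
  (* Unfold the coaction on monomials inside the first tensor factor. *)
  rewrite (eq_tmapl _ (f' := tmap (x ^+ i \o* iota) idfun \o rho)); last first.
    by move=> s /=; rewrite skew_coact_monom.
  rewrite -[X in _ = tassoc X](@tmap_comp _ _ _ _ _ _ _ _ idfun rho idfun).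
  rewrite tassoc_natural_l -rhoA tmap_comp.
  exact: eq_tmapl.
elim/skew_ind: a => [|a b iha ihb|r i]; first by rewrite !linear0 linear0l.
  by rewrite !linearD /= iha ihb linearDl.
rewrite /= skew_coact_monom /coact_monom tmap_comp.
have -> : iota r * x ^+ i *t (1 : K^o)
    = tmap (x ^+ i \o* iota) idfun (r *t (1 : K^o)) by rewrite tmapE.
by rewrite -rho1 tmap_comp; apply: eq_tmapl.
Qed.


Lemma tmul_monom i (u v : (R ⊗ H)%type) :
  tmul (tmap iota idfun u) (tmap (x ^+ i \o* iota) idfun v) =
  tmap (x ^+ i \o* iota) idfun (tmul u v).
Proof.
elim/tens_ind: u => [|a g u ihu]; first by rewrite !(linear0, linear0l).
rewrite linearD /= !linearDl /= linearD /= ihu; congr (_ + _).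
elim/tens_ind: v {ihu} => [|b h v ihv]; first by rewrite !(linear0, linear0r).
rewrite linearD /= !linearDr /= linearD /= ihv.
by rewrite !tmapE !tmulE tmapE /= rmorphM mulrA.
Qed.

(** The commutation rule [x r = sigma(r) x + delta(r)], read in the first
    tensor factor. *)
Lemma tmul_x_monom i (u : (R ⊗ H)%type) :
  tmul (x *t 1) (tmap (x ^+ i \o* iota) idfun u) =
  tmap (x ^+ i.+1 \o* iota) idfun (tmap sigma idfun u)
  + tmap (x ^+ i \o* iota) idfun (tmap delta idfun u).
Proof.
elim/tens_ind: u => [|r h u ih]; first by rewrite !(linear0, linear0r) addr0.
rewrite !linearD /= linearDr /= ih addrACA; congr (_ + _).
rewrite !tmapE tmulE /= mul1r -linearDl /= mulrA (skew_poly_comm skewA) mulrDl.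
by rewrite -mulrA -exprS.
Qed.

Variable rho_sigma : comodule_morphism rho rho sigma.
Variable rho_delta : comodule_morphism rho rho delta.

(** The step where colinearity of [sigma] and [delta] enters: the coaction of
    [x r x^i = sigma(r) x^(i+1) + delta(r) x^i] involves
    [rho (sigma r)] and [rho (delta r)]. *)
Lemma skew_coact_mulx a : skew_coact (x * a) = tmul (x *t 1) (skew_coact a).
Proof.
elim/skew_ind: a => [|a b iha ihb|r i]; first by rewrite mulr0 linear0 linear0r.
  by rewrite mulrDr linearD /= iha ihb linearD linearDr.
rewrite mulrA (skew_poly_comm skewA) mulrDl -mulrA -exprS linearD /=.
by rewrite !skew_coact_monom /coact_monom tmul_x_monom rho_sigma rho_delta.
Qed.

(** A left factor [r x^i] is split as [r], then [x] taken [i] times; associativity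
    of [tmul] puts the pieces together. *)
Lemma skew_coact_comodule_algebra :
  is_comodule_algebra hopfH rho -> is_comodule_algebra hopfH skew_coact.
Proof.
move=> [rho_comod rhoM rho1].
have coact_iota r : skew_coact (iota r) = tmap iota idfun (rho r).
  rewrite -[iota r]mulr1 -(expr0 x) skew_coact_monom.
  by apply: eq_tmapl => s /=; rewrite mulr1.
have coact_iotaM r a : skew_coact (iota r * a)
    = tmul (skew_coact (iota r)) (skew_coact a).
  elim/skew_ind: a => [|a b iha ihb|s i].
  - by rewrite mulr0 linear0 linear0r.
  - by rewrite mulrDr !linearD /= iha ihb linearDr.
  - rewrite mulrA -rmorphM !skew_coact_monom /coact_monom rhoM -tmul_monom.
    by rewrite coact_iota.
have coact_expM i a : skew_coact (x ^+ i * a)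
    = tmul (skew_coact (x ^+ i)) (skew_coact a).
  elim: i => [|i ih]; first by rewrite expr0 -(rmorph1 iota) coact_iotaM.
  by rewrite exprS -mulrA skew_coact_mulx ih tmulA -skew_coact_mulx.
split; first exact: skew_coact_comodule.
- move=> a b; elim/skew_ind: a => [|a1 a2 ih1 ih2|r i].
  + by rewrite mul0r linear0 linear0l.
  + by rewrite mulrDl !linearD /= ih1 ih2 linearDl.
  + by rewrite /= -mulrA !coact_iotaM coact_expM tmulA.
- by rewrite /= -(rmorph1 iota) coact_iota rho1 tmapE.
Qed.

End Extension.
End SkewCoordinates.

Theorem propositionp14
  (K : comNzRingType)
  (H : algType K) (hopfH : hopfAlgebra H) (flatH : flat H)
  (R : algType K) (rhoR : {linear R -> (R ⊗ H)%type})
  (comodR : is_comodule_algebra hopfH rhoR)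
  (sigma : {lrmorphism R -> R}) (delta : {linear R -> R})
  (derivd : skew_derivation sigma delta)
  (A : algType K) (iota : {lrmorphism R -> A}) (x : A)
  (skewA : is_skew_poly iota x sigma delta)
  (comods : comodule_morphism rhoR rhoR sigma)
  (comodd : comodule_morphism rhoR rhoR delta) :
  exists rhoA : {linear A -> (A ⊗ H)%type},
    [/\ forall (n : nat) (r : 'I_n.+1 -> R),
          rhoA (\sum_(i < n.+1) iota (r i) * x ^+ i) =
          \sum_(i < n.+1) tmap (x ^+ i \o* iota) idfun (rhoR (r i)),
        is_comodule_algebra hopfH rhoA,
        (forall r, coinv rhoR r ->
           coinv rhoR (sigma r) /\ coinv rhoR (delta r)) &
        coinv rhoA = skew_polys iota x (coinv rhoR)].
Proof.
exists (skew_coact skewA rhoR); split.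
- move=> n r; rewrite linear_sum /=; apply: eq_bigr => i _.
  exact: skew_coact_monom.
- exact: skew_coact_comodule_algebra comodR.
- by move=> r co_r; split; rewrite /coinv /= ?comods ?comodd co_r tmapE.
- exact: coinv_skew_coact.
Qed.
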